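(* Let $q$ be a prime power and let $V$ be a vector space of dimension $n$ over the finite field $\mathbb{F}_q$. Let $b$ be a positive integer and let $K=\{k_1,\ldots,k_r\}$ and $L=\{\mu_1,\ldots,\mu_s\}$ be two disjoint subsets of $\{0,1,\ldots,b-1\}$ with $k_1<\cdots<k_r$. Let $\mathcal{F}=\{V_1,\ldots,V_m\}$ be a family of subspaces of $V$ such that for every $i\in[m]$, $\dim(V_i)\equiv k_t \pmod b$ for some $k_t\in K$, and for every distinct $i,j\in[m]$, $\dim(V_i\cap V_j)\equiv \mu_t\pmod b$ for some $\mu_t\in L$. Assume that neither of the following holds: (i) $q+1$ is a power of $2$ and $b=2$; (ii) $q=2$ and $b=6$. Then $$|\mathcal{F}|\le \begin{cases} N(n,s,r,q), & \text{if } \big(s+k_r\le n \text{ and } r(s-r+1)\le b-1\big) \text{ or } s<k_1+r,\\ N(n,s,r,q)+\sum_{t\in[r]}\binom{n}{k_t}_q, & \text{otherwise.}\end{cases}$$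
   Context: For integers $a,d$, $\binom{a}{d}_q=\frac{(q^a-1)(q^{a-1}-1)\cdots(q^{a-d+1}-1)}{(q^d-1)(q^{d-1}-1)\cdots(q-1)}$ is the $q$-binomial coefficient (the number of $d$-dimensional subspaces of an $a$-dimensional space over $\mathbb{F}_q$), with the convention $\binom{a}{d}_q=0$ if $d<0$ or $d>a$. $N(n,s,r,q):=\binom{n}{s}_q+\binom{n}{s-1}_q+\cdots+\binom{n}{s-r+1}_q$. $[m]=\{1,\ldots,m\}$. *)

(* Defs.v *)
From HB Require Import structures.
From mathcomp Require Import all_boot all_order all_algebra.

Set Implicit Arguments.
Unset Strict Implicit.
Unset Printing Implicit Defensive.

Import Order.TTheory GRing.Theory Num.Theory.
Local Open Scope ring_scope.

(* Valued in rat so that the defining quotient is a genuine division; d may be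
   negative, as happens in qN below when s < r.-1. *)
Definition qbinomial (q : nat) (a d : int) : rat :=
  if 0 <= d <= a then
    (\prod_(i < `|d|%N) (q%:R ^ (a - i%:Z) - 1))
      / (\prod_(i < `|d|%N) (q%:R ^ (d - i%:Z) - 1))
  else 0.

Definition qN (n s r q : nat) : rat :=
  \sum_(i < r) qbinomial q n%:Z (s%:Z - i%:Z).

(* Main.v *)
(* Zsigmondy's theorem provides a prime p such that q has order b modulo p, so q^k mod p
   determines k mod b. Over F_p, the functions f_i(W) = prod_{mu in L} (q^dim(W cap V_i) - q^mu)
   and phi * [U <= W] with phi(W) = prod_{k in K} (q^dim(W) - q^k) all lie in the span of the
   indicators [U <= W] with dim U <= s. The f_i form a diagonal system on the V_i, where phi
   vanishes, so m + #G <= #{U : dim U <= s} for every set G of subspaces U of dimension at most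
   s - r for which the phi * [U <= W] are independent. One may take the U with dim U not in K,
   since phi does not vanish there. When s + k_r <= n and r (s - r + 1) < b, some s - r + 1
   consecutive dimensions up to n avoid K mod b, and all U with dim U <= s - r may be taken: a
   combination of indicators of degree d that vanishes in dimensions c + 1, ..., c + d + 1
   vanishes in dimension c. *)
Require Import Defs.
From HB Require Import structures.
From mathcomp Require Import all_boot all_order all_fingroup all_algebra all_field mxabelem.
From mathcomp Require Import zify ring.

Set Implicit Arguments.
Unset Strict Implicit.
Unset Printing Implicit Defensive.

Import Order.TTheory GRing.Theory Num.Theory.
Local Open Scope ring_scope.

(** * Values of cyclotomic polynomials and Zsigmondy's theorem *)

Definition cyclotomic_nat (n a : nat) : nat := `|('Phi_n).[a%:Z]|%N.

Lemma exprn_mod_Fp (p x k : nat) : prime p -> (0 < x)%N ->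
  ((x%:R : 'F_p) ^+ k == 1) = (p %| x ^ k - 1)%N.
Proof.
move=> pp x0; rewrite -natrX -subr_eq0 -[1]/(1%:R) -natrB ?expn_gt0 ?x0 //.
by rewrite -(dvdn_pcharf (pchar_Fp pp)).
Qed.

(** X^n - 1 is the product of the ['Phi_d] with d | n. Those with d | e make up X^e - 1, and
    ['Phi_n] is not among them because e < n. *)
Lemma dvdn_cyclotomic (n a e : nat) : (0 < a)%N -> (e %| n)%N -> (0 < e < n)%N ->
  ((a ^ e - 1) * cyclotomic_nat n a %| a ^ n - 1)%N.
Proof.
move=> a0 en /andP[e0 ltn].
have n0 : (0 < n)%N by apply: leq_trans ltn.
have E : exists c : {poly int}, 'X^n - 1 = ('X^e - 1) * 'Phi_n * c.
  exists (\prod_(d <- divisors n | (d != n) && ~~ (d %| e)%N) 'Phi_d).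
  rewrite -!prod_Cyclotomic // (bigD1_seq n) ?divisors_uniq //=; last first.
    by rewrite -dvdn_divisors.
  rewrite (bigID (fun d => d %| e)%N) /= mulrA; congr (_ * _); rewrite mulrC; congr (_ * _).
  rewrite -big_filter; apply: perm_big; apply: uniq_perm.
  - by rewrite filter_uniq ?divisors_uniq.
  - by rewrite divisors_uniq.
  move=> d; rewrite mem_filter -!dvdn_divisors //.
  apply/idP/idP => [/andP[/andP[]]//|de].
  rewrite de (dvdn_trans de en) !andbT.
  by apply/eqP => E; move: (dvdn_leq e0 de); rewrite E leqNgt ltn.
have [c /(congr1 (fun p : {poly int} => `|p.[a%:Z]|%N))] := E.
rewrite !hornerE !abszM.
have H k : `|(a%:Z ^+ k - 1)|%N = (a ^ k - 1)%N.
  have : (0 < a ^ k)%N by rewrite expn_gt0 a0.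
  by rewrite -(natz a) -natrX natz; move: (a ^ k)%N => x; lia.
rewrite !H => ->.
exact: dvdn_mulr.
Qed.

(** The factor a^(n/l) - 1 cancels from [dvdn_cyclotomic] with e = n/l, since a^n - 1 is that factor
    times the geometric sum. *)
Lemma dvdn_cyclotomic_geom (n a l : nat) : (1 < a)%N -> (l %| n)%N -> (1 < l)%N -> (0 < n)%N ->
  (cyclotomic_nat n a %| \sum_(i < l) (a ^ (n %/ l)) ^ i)%N.
Proof.
move=> a1 ln l1 n0.
have e0 : (0 < n %/ l)%N by rewrite divn_gt0 ?(dvdn_leq n0) // ltnW.
have := @dvdn_cyclotomic n a (n %/ l) (ltnW a1) (dvdn_div ln).
rewrite e0 ltn_Pdiv // => /(_ isT).
have -> : (a ^ n - 1 = (a ^ (n %/ l) - 1) * \sum_(i < l) (a ^ (n %/ l)) ^ i)%N.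
  by rewrite -{1}(divnK ln) expnM !subn1 -predn_exp.
by rewrite dvdn_pmul2l // subn_gt0 -{1}(exp1n (n %/ l)) ltn_exp2r.
Qed.

Lemma sum_geom_mod (p x l : nat) : x = 1 %[mod p] -> \sum_(i < l) x ^ i = l %[mod p].
Proof.
move=> x1; elim: l => [|l IH]; first by rewrite big_ord0.
rewrite big_ord_recr /= -modnDml IH modnDml -modnDmr -modnXm x1 modnXm exp1n modnDmr.
by rewrite addn1.
Qed.

(* Modulo p^2, for p odd and x = 1 + p t, the sum is p + p t * (p (p - 1) / 2). *)
Lemma sum_geom_pndvd2 (p x : nat) : odd p -> (1 < p)%N -> (0 < x)%N -> x = 1 %[mod p] ->
  ~~ (p ^ 2 %| \sum_(i < p) x ^ i)%N.
Proof.
move=> op p1 x0 x1.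
have [t xE] : exists t, x = (t * p + 1)%N.
  by exists (x %/ p)%N; rewrite {1}(divn_eq x p) x1 modn_small.
have H i : x ^ i = i * (t * p) + 1 %[mod p ^ 2].
  elim: i => [|i IH]; first by rewrite mul0n.
  rewrite expnSr -modnMml IH modnMml xE.
  have -> : ((i * (t * p) + 1) * (t * p + 1) = (i * t ^ 2) * p ^ 2 + (i.+1 * (t * p) + 1))%N by ring.
  by rewrite modnMDl.
have S l : \sum_(i < l) x ^ i = 'C(l, 2) * (t * p) + l %[mod p ^ 2].
  elim: l => [|l IH]; first by rewrite big_ord0.
  rewrite big_ord_recr /= -modnDml IH modnDml -modnDmr H modnDmr.
  by rewrite binS bin1; congr (_ %% _)%N; ring.
rewrite /dvdn S bin2odd // -mulnA (_ : (p.-1./2 * (t * p) = (p.-1./2 * t) * p)%N); last by ring.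
rewrite mulnCA mulnn modnMDl modn_small; first by rewrite -lt0n ltnW.
by rewrite -[ltnLHS]expn1 ltn_exp2l.
Qed.

(** Let e be the order of a modulo p. For a prime l dividing n/e, p divides a geometric sum of l
    terms congruent to 1, so p | l and l = p. Hence n/e is a power of p, nontrivial because the
    order is not n; the same sum with l = p excludes p^2. *)
Lemma cyclotomic_nonprimitive (n a p : nat) : (2 < n)%N -> (1 < a)%N -> prime p ->
    (p %| cyclotomic_nat n a)%N -> ~~ n.-primitive_root (a%:R : 'F_p) ->
  exists e k, [/\ n = (e * p ^ k)%N, (0 < k)%N, (e %| p.-1)%N
                & ~~ (p ^ 2 %| cyclotomic_nat n a)%N].
Proof.
move=> n2 a1 pp pN nprim.
have a0 : (0 < a)%N := ltnW a1; have n0 : (0 < n)%N by apply: leq_trans n2.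
have n1 : (1 < n)%N by apply: leq_trans n2.
have pan : (p %| a ^ n - 1)%N.
  apply: dvdn_trans pN _; apply: dvdn_trans (dvdn_cyclotomic a0 (dvd1n n) _); last by rewrite n1.
  exact: dvdn_mull.
have [|e prime_e en] := @prim_order_exists _ n (a%:R : 'F_p) n0.
  by apply/eqP; rewrite exprn_mod_Fp.
have e0 : (0 < e)%N := prim_order_gt0 prime_e.
have eX k : (e %| k)%N = (a ^ k == 1 %[mod p])%N.
  by rewrite (prim_order_dvd prime_e) exprn_mod_Fp // eqn_mod_dvd // expn_gt0 a0.
have ap : (0 < a %% p)%N.
  rewrite lt0n; apply/negP => pa.
  have : (p %| 1)%N by rewrite -(@dvdn_addr (a ^ n - 1)) // subnK ?expn_gt0 ?a0 // dvdn_exp.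
  by rewrite dvdn1 => /eqP p1; rewrite p1 in pp.
have ep : (e %| p.-1)%N.
  rewrite (prim_order_dvd prime_e); apply/eqP.
  have u : (a%:R : 'F_p) != 0.
    by rewrite -(dvdn_pcharf (pchar_Fp pp)) /dvdn -lt0n.
  apply: (mulfI u); rewrite mulr1 -exprS prednK ?prime_gt0 //.
  by have := expf_card (a%:R : 'F_p); rewrite card_Fp.
have neq : e != n by apply: contraNneq nprim => <-.
have lp l : prime l -> (l %| n %/ e)%N -> l = p.
  move=> pl le.
  have ln : (l %| n)%N by rewrite -(divnK en) dvdn_mulr.
  have enl : (e %| n %/ l)%N by rewrite dvdn_divRL // mulnC -(divnK en) dvdn_mul.
  move: enl; rewrite eX => /eqP /(@sum_geom_mod p _ l) S.
  have := dvdn_trans pN (dvdn_cyclotomic_geom a1 ln (prime_gt1 pl) n0).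
  rewrite /dvdn S => /eqP/eqP pl'.
  by apply/esym/eqP; rewrite -dvdn_prime2.
have ne0 : (0 < n %/ e)%N by rewrite divn_gt0 // dvdn_leq.
have pnat_ne : p.-nat (n %/ e)%N.
  by apply/(pnatP _ ne0) => l pl dl; rewrite (lp l pl dl) inE /=.
have [k nek] := p_natP pnat_ne.
have nE : n = (e * p ^ k)%N by rewrite -nek mulnC divnK.
have k0 : (0 < k)%N.
  by rewrite lt0n; apply: contra neq => /eqP k0; rewrite nE k0 muln1.
exists e, k; split => //.
have pn : (p %| n)%N by rewrite nE dvdn_mull // dvdn_exp.
have enp : (e %| n %/ p)%N by rewrite nE -(prednK k0) expnSr mulnA mulnK ?prime_gt0 // dvdn_mulr.
have := dvdn_cyclotomic_geom a1 pn (prime_gt1 pp) n0.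
have xp : (a ^ (n %/ p) = 1 %[mod p])%N by apply/eqP; rewrite -eX.
case: (even_prime pp) => [p2|op]; last first.
  move=> D; apply/negP => /dvdn_trans/(_ D); apply/negP.
  by apply: sum_geom_pndvd2 => //; rewrite ?prime_gt1 ?expn_gt0 ?a0.
(* For p = 2, n = 2^k with k >= 2, so a^(n/2) is an odd square and 1 + a^(n/2) is 2 modulo 4. *)
rewrite p2 in ep nE xp *.
have e1 : e = 1%N by apply/eqP; rewrite -dvdn1.
rewrite {}e1 mul1n in nE *.
have k1 : (1 < k)%N by move: n2; rewrite nE; case: (k) k0 => [|[|]].
have -> : (n %/ 2 = 2 ^ (k - 2) * 2)%N.
  by rewrite nE -{1}(subnK k1) expnD mulnA mulnK.
rewrite big_ord_recr big_ord1 /= expn1 expn0 expnM => D.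
have oa : odd (a ^ 2 ^ (k - 2)).
  by move: ap; rewrite p2 modn2 oddX; case: (odd a); rewrite // orbT.
apply/negP => /dvdn_trans/(_ D); rewrite -(odd_double_half (a ^ _)) oa.
set t := _./2; rewrite -muln2 (_ : (1 + (1 + t * 2) ^ 2 = (t ^ 2 + t) * 2 ^ 2 + 2)%N); last by ring.
by rewrite /dvdn modnMDl.
Qed.

Lemma cyclotomic_nat_prod (n a : nat) (z : algC) : n.-primitive_root z ->
  (cyclotomic_nat n a)%:R = \prod_(k < n | coprime k n) `|a%:R - z ^+ k|.
Proof.
move=> pz; rewrite natr_absz intr_norm -normr_prod.
have -> : \prod_(k < n | coprime k n) (a%:R - z ^+ k) = (map_poly intr 'Phi_n).[(a%:Z)%:~R].
  rewrite (Cintr_Cyclotomic pz) horner_prod.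
  by apply: eq_bigr => k _; rewrite !hornerE.
by rewrite horner_map.
Qed.

Lemma card_coprime_ord n : #|[pred k : 'I_n | coprime k n]| = totient n.
Proof.
rewrite totient_count_coprime -big_mkcond big_mkord -sum1_card.
by apply: eq_bigl => k; rewrite inE coprime_sym.
Qed.

(** Each factor |a - w|, with w on the unit circle, is at least a - 1 >= 2. *)
Lemma leq_expn_cyclotomic (n a : nat) : (2 < a)%N -> (0 < n)%N ->
  (2 ^ totient n <= cyclotomic_nat n a)%N.
Proof.
move=> a2 n0; have [z pz] := C_prim_root_exists n0.
rewrite -(ler_nat algC) (cyclotomic_nat_prod a pz) natrX -card_coprime_ord -prodr_const.
apply: ler_prod => k _; rewrite ler0n /=.
apply: le_trans (lerB_dist _ _).
have -> : `|z ^+ k| = 1.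
  rewrite normrX; have -> : `|z| = 1; last exact: expr1n.
  by apply/eqP; rewrite -(pexpr_eq1 n0) // -normrX (prim_expr_order pz) normr1.
by rewrite normr_nat lerBrDr natr1 ler_nat.
Qed.

(* With x = |1 - w|^2 for a root of unity w, |a - w|^2 = (a - 1)^2 + a x >= 1 + 2 x and
   (1 + 2 x)^3 >= 27 x^2, while the product of the x over the primitive roots is
   Phi_n(1)^2 >= 1. *)
Lemma leq_expn_cyclotomic_sq (n a : nat) : (1 < a)%N -> (1 < n)%N ->
  (3 ^ totient n <= cyclotomic_nat n a ^ 2)%N.
Proof.
move=> a1 n1; have n0 := ltnW n1; have [z pz] := C_prim_root_exists n0.
suff H : ((3 ^ totient n) ^ 3 <= (cyclotomic_nat n a ^ 2) ^ 3)%N by rewrite -(@leq_exp2r _ _ 3).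
have w1 k : `|z ^+ k| = 1.
  rewrite normrX; have -> : `|z| = 1; last exact: expr1n.
  by apply/eqP; rewrite -(pexpr_eq1 n0) // -normrX (prim_expr_order pz) normr1.
have P1 : (1 <= cyclotomic_nat n 1)%N.
  rewrite lt0n -(pnatr_eq0 algC) (cyclotomic_nat_prod 1 pz) prodf_seq_neq0.
  apply/allP => k _; apply/implyP => ck; rewrite normr_eq0 subr_eq0 eq_sym -(prim_order_dvd pz).
  apply/negP => nk; move: ck; rewrite /coprime (gcdn_idPr nk) => /eqP E.
  by rewrite E in n1.
have -> : ((3 ^ totient n) ^ 3 = 27 ^ totient n)%N by rewrite -expnM mulnC expnM.
rewrite -(ler_nat algC) !natrX (cyclotomic_nat_prod a pz).
rewrite -!exprM.
(* Multiplying by Phi_n(1)^4, the product of the x^2, reduces the claim to one inequality per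
   primitive root. *)
have P2 : (27%:R ^+ totient n : algC) <= 27%:R ^+ totient n * ((cyclotomic_nat n 1)%:R) ^+ 4.
  by rewrite ler_peMr ?exprn_ege1 ?ler1n // exprn_ge0 // ler0n.
apply: le_trans P2 _.
rewrite (cyclotomic_nat_prod 1 pz) -!prodrXl -card_coprime_ord -prodr_const -big_split /=.
apply: ler_prod => k _; rewrite mulr_ge0 ?ler0n ?exprn_ge0 //=.
set w := z ^+ k; set x : algC := `|1 - w| ^+ 2.
have x0 : 0 <= x by rewrite exprn_ge0.
have ww : w * w^* = 1 by rewrite -normCK w1 expr1n.
have xE : x = 1 + 1 - (w + w^*).
  rewrite /x normCK rmorphB /= rmorph1 (_ : _ * _ = 1 - (w + w^*) + w * w^*); last by ring.
  by rewrite ww; ring.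
have E : `|a%:R - w| ^+ 2 = (a%:R - 1) ^+ 2 + a%:R * x.
  rewrite normCK rmorphB /= rmorph_nat xE.
  rewrite (_ : _ * _ = a%:R ^+ 2 - a%:R * (w + w^*) + w * w^*); last by ring.
  rewrite ww; ring.
rewrite -[4%N]/(2 * 2)%N -[(2 * 3)%N]/(2 * 3)%N !exprM E -/x.
have a2 : 2%:R <= a%:R :> algC by rewrite ler_nat.
have L : 1 + 2%:R * x <= (a%:R - 1) ^+ 2 + a%:R * x.
  apply: lerD; last by rewrite ler_wpM2r.
  by rewrite exprn_ege1 // lerBrDr.
apply: (@le_trans _ _ ((1 + 2%:R * x) ^+ 3)); last first.
  by rewrite lerXn2r // nnegrE addr_ge0 ?mulr_ge0 ?exprn_ge0 ?ler0n // subr_ge0 ler1n ltnW.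
rewrite -subr_ge0.
rewrite (_ : _ - _ = (x - 1) ^+ 2 * (8%:R * x + 1)); last by ring.
rewrite mulr_ge0 //; last by rewrite addr_ge0 ?mulr_ge0 ?ler0n.
by rewrite -realEsqr rpredB ?ger0_real.
Qed.

Lemma prim_root_prime (R : nzRingType) (l : nat) (x : R) : prime l ->
  x ^+ l = 1 -> x != 1 -> l.-primitive_root x.
Proof.
move=> pl xl x1; have [m pm] := prim_order_exists (prime_gt0 pl) xl.
case/primeP: pl => _ H /H /orP[] /eqP mE; last by rewrite -mE.
by move: x1; rewrite -[x]expr1 -(prim_order_dvd pm) mE.
Qed.

(** If l is a prime factor of the value, then n = e l^k with e | l - 1, so no prime factor of n
    exceeds l. Every prime factor of the value divides n, so there is only one, and it occurs to the
    first power. *)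
Lemma cyclotomic_nonprimitive_dvdn (n a : nat) : (2 < n)%N -> (1 < a)%N ->
    (forall p, prime p -> (p %| cyclotomic_nat n a)%N -> ~~ n.-primitive_root (a%:R : 'F_p)) ->
  exists p e k, [/\ prime p, (cyclotomic_nat n a %| p)%N, n = (e * p ^ k.+1)%N & (e %| p.-1)%N].
Proof.
move=> n2 a1 H; set N := cyclotomic_nat n a.
have N1 : (1 < N)%N.
  rewrite -(@ltn_exp2r _ _ 2) //; apply: leq_trans (leq_expn_cyclotomic_sq a1 (ltnW n2)).
  have : (0 < totient n)%N by rewrite totient_gt0 (ltn_trans _ n2).
  by move=> t0; rewrite -[ltnLHS]/(3 ^ 0)%N ltn_exp2l.
have pp : prime (pdiv N) by apply: pdiv_prime.
have pN : (pdiv N %| N)%N by apply: pdiv_dvd.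
set p := pdiv N in pp pN *.
have [e [k [nE k0 ep pp2]]] := cyclotomic_nonprimitive n2 a1 pp pN (H p pp pN).
have le l l' : prime l -> (l %| N)%N -> prime l' -> (l' %| N)%N -> (l' <= l)%N.
  move=> pl lN pl' lN'.
  have [e1 [k1 [nE1 k10 ep1 _]]] := cyclotomic_nonprimitive n2 a1 pl lN (H l pl lN).
  have [e2 [k2 [nE2 k20 _ _]]] := cyclotomic_nonprimitive n2 a1 pl' lN' (H l' pl' lN').
  have : (l' %| n)%N by rewrite nE2 dvdn_mull // dvdn_exp.
  rewrite nE1 Euclid_dvdM // Euclid_dvdX // k10 andbT => /orP[d|]; last first.
    by rewrite dvdn_prime2 // => /eqP ->.
  have l0 : (0 < l.-1)%N by rewrite -ltnS prednK ?prime_gt0 // prime_gt1.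
  by apply: leq_trans (leq_pred _); apply: dvdn_leq => //; apply: dvdn_trans ep1.
have pnN : p.-nat N.
  apply/(pnatP _ (ltnW N1)) => l pl lN; rewrite inE /=.
  by rewrite eqn_leq !le.
exists p, e, k.-1; split; rewrite ?prednK //.
have [v NE] := p_natP pnN.
have v1 : (v <= 1)%N.
  by rewrite leqNgt; apply: contra pp2 => v2; rewrite -/N NE dvdn_exp2l.
by rewrite NE -[X in (_ %| X)%N]expn1 dvdn_exp2l.
Qed.

(** For n > 2, if no prime factor of N = Phi_n(a) works, then N divides a prime p with p - 1 <=
    totient n, while 3^(totient n) <= N^2 <= p^2. This forces p <= 3 and leaves small cases. *)
Theorem zsigmondy (a n : nat) : (1 < a)%N -> (1 < n)%N ->
    ~ ((exists e, a + 1 = 2 ^ e)%N /\ n = 2%N) -> ~ (a = 2%N /\ n = 6%N) ->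
  exists2 p, prime p & n.-primitive_root (a%:R : 'F_p).
Proof.
move=> a1 n1 ex1 ex2.
have [nE|n2] := eqVneq n 2%N.
  (* An odd prime factor p of a + 1 serves, as a is then -1 and not 1 modulo p. *)
  rewrite {}nE in ex1 *.
  have : ~~ (2.-nat (a + 1))%N by apply/negP => /p_natP[k kE]; apply: ex1; split => //; exists k.
  rewrite /pnat addn1 /= => /allPn[p]; rewrite mem_primes inE /= => /andP[pp pa] p2.
  have p_gt2 : (2 < p)%N by have := prime_gt1 pp; rewrite leq_eqVlt eq_sym (negPf p2).
  have x1 : (a%:R : 'F_p) = -1.
    by apply/eqP; rewrite -subr_eq0 opprK natr1 -(dvdn_pcharf (pchar_Fp pp)).
  exists p => //; apply: prim_root_prime; rewrite // x1 ?sqrrN ?expr1n //.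
  rewrite eq_sym -subr_eq0 opprK -[1 + 1]/(2%:R) -(dvdn_pcharf (pchar_Fp pp)).
  by apply/negP => /(dvdn_leq (isT : (0 < 2)%N)); rewrite leqNgt p_gt2.
have {n2} n2 : (2 < n)%N by rewrite ltn_neqAle eq_sym n2.
set N := cyclotomic_nat n a.
have [/hasP[p]|/hasPn H] := boolP (has (fun p => n.-primitive_root (a%:R : 'F_p)) (primes N)).
  by rewrite mem_primes => /and3P[pp _ _] ?; exists p.
have N2 := leq_expn_cyclotomic_sq a1 n1; rewrite -/N in N2.
have N0 : (0 < N)%N by move: N2; case: (N) => //; rewrite exp0n // leqn0 expn_eq0.
have [p pp pN|p [e [k [pp Np nE ep]]]] := cyclotomic_nonprimitive_dvdn n2 a1.
  by apply: H; rewrite mem_primes pp N0.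
have p0 := prime_gt0 pp; have p1 := prime_gt1 pp.
have {}Np : (N <= p)%N := dvdn_leq p0 Np.
have cop : coprime e (p ^ k.+1).
  rewrite coprimeXr // coprime_sym prime_coprime //; apply/negP => /dvdn_trans/(_ ep).
  by move/dvdn_leq; rewrite -subn1 subn_gt0 p1 => /(_ isT); lia.
have tn : totient n = (totient e * (p.-1 * p ^ k))%N.
  by rewrite nE totient_coprime // totient_pfactor.
have e0 : (0 < e)%N by move: n1; rewrite nE; case: (e).
have te0 : (0 < totient e)%N by rewrite totient_gt0.
have pk0 : (0 < p ^ k)%N by rewrite expn_gt0 p0.
have B : (3 ^ totient n <= p ^ 2)%N by apply: leq_trans N2 _; rewrite leq_exp2r.
have tp : (p.-1 <= totient n)%N.
  by rewrite tn mulnC -mulnA leq_pmulr // muln_gt0 pk0.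
have {}B c : (c <= totient n)%N -> (3 ^ c <= p ^ 2)%N.
  by move=> ct; apply: leq_trans B; rewrite leq_exp2l.
(* 3^(p - 1) exceeds p^2 from p = 4 on. *)
have p_lt4 : (p < 4)%N.
  rewrite ltnNge; apply/negP => p4; have := B _ tp; apply/negP; rewrite -ltnNge.
  rewrite -(subnK p4); elim: (p - 4)%N => // d; rewrite addSn addn4 /= => IH.
  rewrite expnS; apply: (@leq_trans (3 * d.+4 ^ 2)%N); first by nia.
  by rewrite leq_mul2l /= ltnW.
have {p_lt4} [p2|p3] : p = 2%N \/ p = 3%N by lia.
  rewrite p2 in tn ep nE B.
  have e1 : e = 1%N by apply/eqP; rewrite -dvdn1.
  rewrite e1 mul1n in nE.
  have k0 : (0 < k)%N by move: n2; rewrite nE; case: (k).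
  have /B// : (2 <= totient n)%N.
  rewrite tn e1 /= mul1n (_ : totient 1 = 1%N) // mul1n.
  by rewrite -(prednK k0) expnS leq_pmulr // expn_gt0.
rewrite p3 in tn ep nE B Np tp.
have k0 : k = 0%N.
  case: k {nE cop pk0} tn => // k tn; have /B// : (6 <= totient n)%N.
  have k0 : (0 < 3 ^ k)%N by rewrite expn_gt0.
  by rewrite tn expnS /=; move: (totient e) (3 ^ k)%N te0 k0 => x y; nia.
rewrite k0 expn1 in nE.
(* For a >= 3 one would have 2^2 <= 2^(totient n) <= N <= 3. *)
have a2 : a = 2%N.
  apply/eqP; rewrite eqn_leq a1 andbT leqNgt; apply/negP => a2.
  have := leq_trans (leq_expn_cyclotomic a2 (ltnW n1)) Np.
  by apply/negP; rewrite -ltnNge; apply: (@leq_trans (2 ^ 2)%N); rewrite // leq_exp2l.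
have eE : e = 1%N.
  have := dvdn_leq (isT : (0 < 2)%N) ep.
  by case: (e) e0 nE => [|[|[|]]] // _ nE _; case: ex2.
(* Now n = 3, and 2 has order 3 modulo 7. *)
exists 7%N => //; rewrite nE eE a2.
by apply: prim_root_prime => //; apply/eqP; rewrite exprn_mod_Fp.
Qed.

(** * Functions on subspaces spanned by containment indicators *)

Section SubspaceFunctions.
Variables (F : finFieldType) (K : fieldType) (n : nat).
Implicit Types (U V W H : 'M[F]_n) (g h : 'M[F]_n -> K).

Definition indic U W : K := (U <= W)%MS%:R.

(* A d-polynomial on H is a combination of the indicators of the W containing U, for
   U <= H of rank at most d. Such functions play the role of polynomials of degree d. *)
Inductive spoly H (d : nat) : ('M[F]_n -> K) -> Prop :=
| spoly0 : spoly H d (fun _ => 0)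
| spoly_indic U : (U <= H)%MS -> (\rank U <= d)%N -> spoly H d (indic U)
| spoly_lin c g h : spoly H d g -> spoly H d h -> spoly H d (fun W => c * g W + h W)
| spoly_ext g h : (forall W, g W = h W) -> spoly H d g -> spoly H d h.

Lemma spoly1 H d : spoly H d (fun _ => 1).
Proof.
apply: (@spoly_ext _ _ (indic 0)) => [W|]; first by rewrite /indic sub0mx.
by apply: spoly_indic; rewrite ?sub0mx ?mxrank0.
Qed.

Lemma spoly_scale H d c g : spoly H d g -> spoly H d (fun W => c * g W).
Proof.
move=> Hg; apply: (spoly_ext _ (spoly_lin c Hg (spoly0 H d))) => W.
by rewrite addr0.
Qed.

Lemma spoly_add H d g h : spoly H d g -> spoly H d h -> spoly H d (fun W => g W + h W).
Proof.
move=> Hg Hh; apply: (spoly_ext _ (spoly_lin 1 Hg Hh)) => W.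
by rewrite mul1r.
Qed.

Lemma spoly_sum H d (I : finType) (P : pred I) (g : I -> 'M[F]_n -> K) :
  (forall i, P i -> spoly H d (g i)) -> spoly H d (fun W => \sum_(i | P i) g i W).
Proof.
move=> Hg.
suff : forall r : seq I, spoly H d (fun W => \sum_(i <- r | P i) g i W) by exact.
elim=> [|i r IH].
  by apply: (spoly_ext _ (spoly0 H d)) => W; rewrite big_nil.
case Pi: (P i); last by apply: (spoly_ext _ IH) => W; rewrite big_cons Pi.
by apply: (spoly_ext _ (spoly_add (Hg i Pi) IH)) => W; rewrite big_cons Pi.
Qed.

(** The product of the indicators of U and V is that of U + V, whose rank is at most the sum of the
    ranks. *)
Lemma spoly_mul H d e g h : spoly H d g -> spoly H e h -> spoly H (d + e) (fun W => g W * h W).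
Proof.
move=> Hg Hh; elim: Hg => [|U UH Ud|c g1 g2 _ IH1 _ IH2|g1 g2 E _ IH].
- by apply: (spoly_ext _ (spoly0 _ _)) => W; rewrite mul0r.
- elim: Hh => [|V VH Ve|c h1 h2 _ IH1 _ IH2|h1 h2 E _ IH].
  + by apply: (spoly_ext _ (spoly0 _ _)) => W; rewrite mulr0.
  + apply: (@spoly_ext _ _ (indic (U + V)%MS)) => [W|].
      by rewrite /indic addsmx_sub -natrM mulnb.
    apply: spoly_indic; first by rewrite addsmx_sub UH.
    by apply: leq_trans (mxrank_adds_leqif _ _) _; apply: leq_add.
  + by apply: (spoly_ext _ (spoly_lin c IH1 IH2)) => W; ring.
  + by apply: (spoly_ext _ IH) => W; rewrite E.
- by apply: (spoly_ext _ (spoly_lin c IH1 IH2)) => W; ring.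
- by apply: (spoly_ext _ IH) => W; rewrite E.
Qed.

Lemma spoly_prod H (T : Type) (r : seq T) (g : T -> 'M[F]_n -> K) :
  (forall i, spoly H 1 (g i)) -> spoly H (size r) (fun W => \prod_(i <- r) g i W).
Proof.
move=> Hg; elim: r => [|i r IH].
  by apply: (spoly_ext _ (spoly1 _ _)) => W; rewrite big_nil.
by apply: (spoly_ext _ (spoly_mul (Hg i) IH)) => W; rewrite big_cons.
Qed.

(** The index set consists of canonical matrices [<<U>>], one for each subspace, so that the number
    of terms counts subspaces. *)
Lemma spoly_coef H d g : spoly H d g ->
  exists a : 'M[F]_n -> K, forall W,
    g W = \sum_(U | (<<U>>%MS == U) && (\rank U <= d)%N) a U * indic U W.
Proof.
elim=> [|U UH Ud|c g1 g2 _ [a1 E1] _ [a2 E2]|g1 g2 E _ [a Ea]].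
- by exists (fun _ => 0) => W; rewrite big1 // => U _; rewrite mul0r.
- exists (fun V => (V == <<U>>%MS)%:R) => W.
  rewrite (bigD1 <<U>>%MS) /=; last by rewrite genmx_id eqxx mxrank_gen.
  rewrite eqxx mul1r /indic genmxE big1 ?addr0 // => V /andP[_ /negPf->].
  by rewrite mul0r.
- exists (fun U => c * a1 U + a2 U) => W.
  by rewrite E1 E2 mulr_sumr -big_split; apply: eq_bigr => U _ /=; ring.
- by exists a => W; rewrite -E.
Qed.

Lemma card_rowspace m (A : 'M[F]_(m, n)) :
  #|[pred v : 'rV[F]_n | (v <= A)%MS]| = (#|F| ^ \rank A)%N.
Proof. by rewrite -card_rowg; apply: eq_card => v; rewrite mem_rowg inE. Qed.

(** The power of q is the number of v in V that lie in W, hence a sum of indicators of spans of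
    single vectors. *)
Lemma spoly_qrank V : spoly 1%:M 1 (fun W => #|F|%:R ^+ \rank (W :&: V)%MS).
Proof.
have H : spoly 1%:M 1 (fun W => \sum_(v : 'rV[F]_n | (v <= V)%MS) indic <<v>>%MS W).
  by apply: spoly_sum => v _; apply: spoly_indic; rewrite ?submx1 // mxrank_gen rank_leq_row.
apply: (spoly_ext _ H) => W.
rewrite -natrX -card_rowspace -sum1_card natr_sum [RHS]big_mkcond [LHS]big_mkcond /=.
apply: eq_bigr => v _.
by rewrite /indic genmxE inE sub_capmx; case: (v <= V)%MS; case: (v <= W)%MS.
Qed.

End SubspaceFunctions.

(** * Slicing along a hyperplane and descent in dimension *)

Section Descent.
Variables (F : finFieldType) (K : fieldType) (n : nat).
Implicit Types (U V W H : 'M[F]_n) (g h : 'M[F]_n -> K) (e v : 'rV[F]_n).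

Lemma sub_rowP m (A : 'M[F]_n) (u : 'rV[F]_n) (B : 'M[F]_(m, n)) :
  reflect (exists w : 'rV[F]_n, exists2 c : 'M[F]_(1, m), (w <= A)%MS & u = w + c *m B)
    (u <= A + B)%MS.
Proof.
apply: (iffP sub_addsmxP) => [[[a b] /= ->]|[w [c wA ->]]].
  by exists (a *m A), b; rewrite ?submxMl.
by exists (w *m pinvmx A, c); rewrite /= mulmxKpV.
Qed.

Lemma not_submx_row m p (A : 'M[F]_(m, n)) (B : 'M[F]_(p, n)) : ~~ (A <= B)%MS ->
  exists2 v : 'rV[F]_n, (v <= A)%MS & ~~ (v <= B)%MS.
Proof. by case/row_subPn => i Hi; exists (row i A); rewrite ?row_sub. Qed.

Lemma rank_adds_row m (A : 'M[F]_(m, n)) e : ~~ (e <= A)%MS ->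
  \rank (A + e)%MS = (\rank A).+1.
Proof.
move=> eA; apply/eqP; rewrite eqn_leq; apply/andP; split.
  apply: leq_trans (mxrank_adds_leqif _ _) _.
  by have := rank_leq_row e; lia.
suff : (A < A + e)%MS by rewrite ltmxErank => /andP[].
by rewrite ltmxE addsmxSl /=; apply: contra eA; apply: submx_trans (addsmxSr _ _).
Qed.

Lemma mulmx_scalar11 (c : 'M[F]_1) e : c *m e = c 0 0 *: e.
Proof. by rewrite {1}(mx11_scalar c) mul_scalar_mx. Qed.

Lemma sub_submx m p (A B : 'M[F]_(m, n)) (C : 'M[F]_(p, n)) : (A <= C)%MS -> (B <= C)%MS ->
  ((A - B)%R <= C)%MS.
Proof. by move=> AC BC; rewrite addmx_sub // eqmx_opp. Qed.

Lemma coord_eq0 H e v w (c : F) : ~~ (e <= H)%MS -> (v <= H)%MS -> (w <= H)%MS ->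
  ((w + c *: (e + v))%R <= H)%MS -> c = 0.
Proof.
move=> eH vH wH sH; apply/eqP; apply: contraNT eH => c0.
rewrite -(scalerK c0 e) scalemx_sub //.
have -> : c *: e = (w + c *: (e + v)) - w - c *: v.
  by rewrite [w + _]addrC addrK scalerDr addrK.
by rewrite !sub_submx ?scalemx_sub.
Qed.

(** A vector of U lies in H, so its component along e + v is zero. *)
Lemma sub_adds_off_hyperplane H W U e v : ~~ (e <= H)%MS -> (v <= H)%MS -> (W <= H)%MS ->
  (U <= H)%MS -> (U <= W + (e + v)%R)%MS = (U <= W)%MS.
Proof.
move=> eH vH WH UH; apply/idP/idP => [UW|]; last by move/submx_trans; apply; apply: addsmxSl.
apply/row_subP => i.
have [w [c wW E]] := sub_rowP _ _ _ (submx_trans (row_sub i U) UW).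
rewrite mulmx_scalar11 in E.
have c0 : c 0 0 = 0.
  apply: (coord_eq0 eH vH (submx_trans wW WH)).
  by rewrite -E; apply: submx_trans UH; apply: row_sub.
by rewrite E c0 scale0r addr0.
Qed.

(** U is spanned by its part in H and e + t, and e + t lies in W + <e + v> exactly when t - v lies
    in W. *)
Lemma sub_adds_hyperplane H W U e t v : ~~ (e <= H)%MS -> (v <= H)%MS -> (W <= H)%MS ->
    (t <= H)%MS -> (U <= H + e)%MS -> ((e + t)%R <= U)%MS ->
  (U <= W + (e + v)%R)%MS = (U :&: H <= W)%MS && ((t - v)%R <= W)%MS.
Proof.
move=> eH vH WH tH UHe etU; apply/idP/andP => [UW|[UHW tvW]].
  split.
    rewrite -(@sub_adds_off_hyperplane H W _ e v) ?capmxSr //.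
    by apply: submx_trans UW; apply: capmxSl.
  have [w [c wW]] := sub_rowP _ _ _ (submx_trans etU UW); rewrite mulmx_scalar11 => E.
  have E1 : t - v = w + (c 0 0 - 1) *: (e + v).
    rewrite scalerBl scale1r addrA -E opprD addrACA subrr add0r //.
  have c1 : c 0 0 - 1 = 0.
    apply: (coord_eq0 eH vH (submx_trans wW WH)).
    by rewrite -E1 sub_submx.
  by rewrite E1 c1 scale0r addr0.
apply: (@submx_trans _ _ _ _ _ _ (U :&: H + (e + t)%R)%MS).
  apply/row_subP => i.
  have [y [c yH]] := sub_rowP _ _ _ (submx_trans (row_sub i U) UHe); rewrite mulmx_scalar11 => E.
  apply/sub_rowP; exists (row i U - c 0 0 *: (e + t)), (c 0 0)%:M; last first.
    by rewrite mul_scalar_mx subrK.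
  rewrite sub_capmx addmx_sub ?row_sub ?eqmx_opp ?scalemx_sub //=.
  rewrite E scalerDr opprD addrA addrK.
  by rewrite sub_submx ?scalemx_sub.
rewrite addsmx_sub (submx_trans UHW) ?addsmxSl //=.
apply/sub_rowP; exists (t - v), 1%:M => //.
by rewrite mul1mx addrCA subrK.
Qed.

(* Restricting to the subspaces W + <e + v> and summing over v in a hyperplane H of
   H + <e> lowers the degree by one, up to the factor q^(rank W). *)
Lemma spoly_slice H H1 e d g : (H1 <= H + e)%MS -> ~~ (e <= H)%MS -> spoly H1 d.+1 g ->
  exists2 h : 'M[F]_n -> K, spoly H d h & forall W, (W <= H)%MS ->
    \sum_(v : 'rV[F]_n | (v <= H)%MS) g (W + (e + v)%R)%MS - #|F|%:R ^+ \rank H * g W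
    = #|F|%:R ^+ \rank W * h W.
Proof.
move=> HH1 eH.
elim=> [|U UH1 Ud|c g1 g2 _ [h1 H1h E1] _ [h2 H2h E2]|g1 g2 E _ [h Hh E1]]; last first.
- exists h => // W WH; rewrite -E1 // E; congr (_ - _).
  by apply: eq_bigr => v _; rewrite E.
- exists (fun W => c * h1 W + h2 W); first exact: spoly_lin.
  move=> W WH; transitivity (c * (#|F|%:R ^+ \rank W * h1 W) + #|F|%:R ^+ \rank W * h2 W); last by ring.
  rewrite -E1 // -E2 // big_split /= -mulr_sumr; ring.
(* For U inside H no slice changes the indicator, and the sum over v is q^(rank H) times it. *)
- have [UH|UH] := boolP (U <= H)%MS.
    exists (fun _ => 0); first exact: spoly0.
    move=> W WH; rewrite (eq_bigr (fun _ => indic K U W)); last first.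
      by move=> v vH; rewrite /indic (sub_adds_off_hyperplane eH).
    by rewrite sumr_const card_rowspace -[indic K U W *+ _]mulr_natl natrX subrr mulr0.
  (* Otherwise U contains some e + t with t in H, and no W inside H contains U. *)
  have [u uU uH] := not_submx_row UH.
  have [h0 [c h0H]] := sub_rowP _ _ _ (submx_trans (submx_trans uU UH1) HH1).
  rewrite mulmx_scalar11; move: (c 0 0) => {}c uE.
  have c0 : c != 0 by apply: contraNneq uH => c0; rewrite uE c0 scale0r addr0.
  set t := c^-1 *: h0.
  have tH : (t <= H)%MS by rewrite scalemx_sub.
  have etU : ((e + t)%R <= U)%MS.
    rewrite (_ : e + t = c^-1 *: u) ?scalemx_sub //.
    by rewrite uE scalerDr scalerK // addrC.
  exists (indic K (U :&: H)%MS).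
    apply: spoly_indic; first exact: capmxSr.
    rewrite -ltnS; apply: leq_trans Ud.
    suff : (U :&: H < U)%MS by rewrite ltmxErank => /andP[].
    by rewrite ltmxE capmxSl sub_capmx submx_refl.
  move=> W WH.
  have -> : indic K U W = 0.
    rewrite /indic; have -> : (U <= W)%MS = false; last by [].
    by apply: contraNF UH => /submx_trans; apply.
  rewrite mulr0 subr0.
  rewrite (eq_bigr (fun v => indic K (U :&: H)%MS W * ((t - v)%R <= W)%MS%:R)); last first.
    move=> v vH; rewrite /indic (sub_adds_hyperplane eH vH WH tH _ etU) -?mulnb ?natrM //.
    exact: submx_trans HH1.
  (* The contributing v are those with t - v in W, and there are q^(rank W) of them. *)
  rewrite -mulr_sumr mulrC; congr (_ * _).
  rewrite -natrX -card_rowspace -sum1_card natr_sum [RHS]big_mkcond [LHS]big_mkcond /=.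
  rewrite [RHS](reindex_inj (can_inj (subKr t))); apply: eq_bigr => v _.
  rewrite inE; case: ifP => [vH|vH]; first by case: ifP.
  case: ifP => // tv; move: vH; rewrite -(subKr t v) sub_submx //.
  exact: submx_trans WH.
- exists (fun _ => 0); first exact: spoly0.
  by move=> W WH; rewrite big1 // !mulr0 subrr.
Qed.

Lemma spoly0_const H g W W' : spoly H 0 g -> g W = g W'.
Proof.
elim=> [|U _|c g1 g2 _ IH1 _ IH2|g1 g2 E _ IH] //; last by rewrite -!E.
- by rewrite leqn0 mxrank_eq0 => /eqP->; rewrite /indic !sub0mx.
- by rewrite IH1 IH2.
Qed.

(** Induction on d. Take e in H outside W and a hyperplane H' of H that contains W and misses e.
    Slices raise the rank by one, so the function h of degree d - 1 given by [spoly_slice] vanishes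
    in ranks c + 1 to c + d. Hence h W = 0, and the slicing identity at W leaves q^(rank H') g W =
    0. *)
Lemma spoly_descent (q0 : #|F|%:R != 0 :> K) d H g c :
    spoly H d g -> (c + d < \rank H)%N ->
    (forall W, (W <= H)%MS -> (c < \rank W <= c + d.+1)%N -> g W = 0) ->
  forall W, (W <= H)%MS -> \rank W = c -> g W = 0.
Proof.
elim: d H g => [|d IH] H g Hg cd g0 W WH rW.
  have /not_submx_row[v vH vW] : ~~ (H <= W)%MS.
    by apply: contraL cd => /mxrankS; rewrite rW addn0 -leqNgt.
  rewrite (@spoly0_const H g _ (W + v)%MS) //; apply: g0; rewrite ?addsmx_sub ?WH //.
  by rewrite rank_adds_row // rW addn1 leqnn.
have /not_submx_row[e eH eW] : ~~ (H <= W)%MS.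
  by apply: contraL cd => /mxrankS; rewrite rW -leqNgt => /leq_trans; apply; apply: leq_addr.
(* Adding to W a complement of W + e in H gives the hyperplane. *)
pose H' := (W + (H :\: (W + e)))%MS.
have WeH : (W + e <= H)%MS by rewrite addsmx_sub WH.
have H'H : (H' <= H)%MS by rewrite addsmx_sub WH diffmxSl.
have WH' : (W <= H')%MS by apply: addsmxSl.
have HH' : (H <= H' + e)%MS.
  rewrite -(addsmx_diff_cap_eq H (W + e)%MS) addsmx_sub; apply/andP; split.
    by apply: submx_trans (addsmxSl _ _); apply: addsmxSr.
  by apply: submx_trans (capmxSr _ _) _; rewrite addsmxS.
have eH' : ~~ (e <= H')%MS.
  apply: contra eW => /sub_addsmxP[[a b] /= E].
  have D : (b *m (H :\: (W + e)) <= (H :\: (W + e)) :&: (W + e))%MS.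
    rewrite sub_capmx submxMl /=.
    have -> : b *m (H :\: (W + e))%MS = e - a *m W.
      by apply/esym/eqP; rewrite subr_eq addrC; apply/eqP.
    apply: sub_submx; first exact: addsmxSr.
    by apply: submx_trans (addsmxSl _ _); apply: submxMl.
  rewrite capmx_diff submx0 in D.
  by rewrite E (eqP D) addr0 submxMl.
have rH' : (c + d < \rank H')%N.
  rewrite -ltnS -(addnS c d); apply: leq_trans cd _.
  by rewrite -(rank_adds_row eH') mxrankS.
have [h Hh E] := spoly_slice HH' eH' Hg.
have rWe W1 v : (W1 <= H')%MS -> (v <= H')%MS -> \rank (W1 + (e + v)%R)%MS = (\rank W1).+1.
  move=> W1H vH; rewrite rank_adds_row //; apply: contra eH' => /submx_trans/(_ W1H) K1.
  by rewrite -(addrK v e) sub_submx.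
have subWe W1 v : (W1 <= H')%MS -> (v <= H')%MS -> (W1 + (e + v)%R <= H)%MS.
  move=> W1H vH; rewrite addsmx_sub (submx_trans W1H) //=.
  by rewrite addmx_sub // (submx_trans vH).
have qX k : (#|F|%:R ^+ k : K) != 0 by rewrite expf_neq0.
have h0 : forall W1, (W1 <= H')%MS -> (c < \rank W1 <= c + d.+1)%N -> h W1 = 0.
  move=> W1 W1H /andP[r1 r2]; apply: (mulfI (qX (\rank W1))); rewrite -E // mulr0.
  rewrite big1 => [|v vH]; last first.
    by apply: g0; rewrite ?subWe // rWe // ltnS (ltnW r1) addnS ltnS.
  by rewrite g0 ?mulr0 ?subrr // ?(submx_trans W1H) // r1 (leq_trans r2) ?leq_add2l.
apply: (mulfI (qX (\rank H'))); rewrite mulr0.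
have := E W WH'; rewrite (IH _ _ Hh rH' h0) // mulr0 big1 => [|v vH].
  by rewrite sub0r => /eqP; rewrite oppr_eq0 => /eqP.
by apply: g0; rewrite ?subWe // rWe // rW ltnSn -addn1 leq_add2l.
Qed.

End Descent.

(** * The linear algebra bound on the family *)

Lemma leq_card_indep (K : fieldType) (I J : finType) (T : Type) (P : pred J)
    (f : I -> T -> K) (x : J -> T -> K) (a : I -> J -> K) :
  (forall i t, f i t = \sum_(j | P j) a i j * x j t) ->
  (forall c : I -> K, (forall t, \sum_i c i * f i t = 0) -> forall i, c i = 0) ->
  (#|I| <= #|P|)%N.
Proof.
move=> fE indep.
(* A vector in the left kernel of [A] yields a vanishing combination of the [f i], hence is zero;
   independent rows are at most as many as the columns. *)
pose A := \matrix_(i < #|I|, j < #|P|) a (enum_val i) (enum_val j).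
suff /eqP <- : row_free A by apply: rank_leq_col.
apply: inj_row_free => v vA.
suff v0 i : v 0 (enum_rank i) = 0.
  by apply/rowP => i; rewrite mxE -(enum_valK i) v0.
apply: (indep (fun i => v 0 (enum_rank i))) => t.
transitivity (\sum_(j | P j) (\sum_i v 0 (enum_rank i) * a i j) * x j t).
  under eq_bigr => k _ do rewrite fE mulr_sumr.
  rewrite exchange_big /=; apply: eq_bigr => j _; rewrite mulr_suml.
  by apply: eq_bigr => k _; rewrite mulrA.
rewrite big1 // => j Pj.
have /rowP/(_ (enum_rank_in Pj j)) := vA; rewrite !mxE => E.
rewrite [X in X * _](_ : _ = 0) ?mul0r // -[RHS]E.
rewrite (reindex _ (onW_bij _ (@enum_val_bij I))) /=; apply: eq_bigr => k _.
by rewrite mxE enum_rankK_in ?enum_valK.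
Qed.

Section Bound.
Variables (F : finFieldType) (K : fieldType) (n b : nat).
Hypothesis pz : b.-primitive_root (#|F|%:R : K).
Variables (Ks Ls : seq nat).
Hypothesis hKb : forall x, x \in Ks -> (x < b)%N.
Hypothesis hLb : forall x, x \in Ls -> (x < b)%N.
Hypothesis hKL : forall x, x \in Ks -> x \notin Ls.
Local Notation r := (size Ks).
Local Notation s := (size Ls).

(** As q has order b in K, q^k = q^x exactly when k and x agree modulo b. *)
Lemma prodf_prim_root_eq0 (S : seq nat) k : (forall x, x \in S -> (x < b)%N) ->
  (\prod_(x <- S) (#|F|%:R ^+ k - #|F|%:R ^+ x : K) == 0) = ((k %% b)%N \in S).
Proof.
move=> Sb; rewrite prodf_seq_eq0; apply/hasP/idP => [[x xS /=]|kS].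
  by rewrite subr_eq0 (eq_prim_root_expr pz) [(x %% _)%N]modn_small ?Sb // => /eqP->.
by exists (k %% b)%N => //=; rewrite subr_eq0 (eq_prim_root_expr pz) modn_mod.
Qed.

Lemma spoly_prod_qrank (S : seq nat) (V : 'M[F]_n) :
  spoly 1%:M (size S) (fun W => \prod_(x <- S) (#|F|%:R ^+ \rank (W :&: V)%MS - #|F|%:R ^+ x : K)).
Proof.
apply: spoly_prod => x.
apply: (spoly_ext _ (spoly_add (spoly_qrank K V) (spoly_scale (- #|F|%:R ^+ x) (spoly1 K 1%:M 1)))) => W.
by rewrite mulr1.
Qed.

(** [D] selects the dimensions of the auxiliary subspaces [G], and the last hypothesis is what their
    independence requires once [phi] is divided out. The right side counts the subspaces of
    dimension at most s outside [G]. *)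
Lemma family_bound (m : nat) (V : 'I_m -> 'M[F]_n) (D : pred nat) :
    (forall i, exists2 k, k \in Ks & (\rank (V i) = k %[mod b])%N) ->
    (forall i j, i != j -> exists2 mu, mu \in Ls & (\rank (V i :&: V j)%MS = mu %[mod b])%N) ->
    (forall d, D d -> (d + r <= s)%N) ->
    (forall g : 'M[F]_n -> K, spoly 1%:M (s - r) g ->
       (forall W, (\rank W %% b)%N \notin Ks -> g W = 0) -> forall W, D (\rank W) -> g W = 0) ->
  (m <= #|[pred U : 'M[F]_n | [&& <<U>>%MS == U, (\rank U <= s)%N & ~~ D (\rank U)]]|)%N.
Proof.
move=> hdim hcap Ds hD.
pose q : K := #|F|%:R.
pose G := [pred U : 'M[F]_n | (<<U>>%MS == U) && D (\rank U)].
pose S := [pred U : 'M[F]_n | (<<U>>%MS == U) && (\rank U <= s)%N].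
pose phi (W : 'M[F]_n) := \prod_(x <- Ks) (q ^+ \rank (W :&: 1%:M)%MS - q ^+ x).
pose f i (W : 'M[F]_n) := \prod_(x <- Ls) (q ^+ \rank (W :&: V i)%MS - q ^+ x).
pose F_ (i : 'I_m + 'I_#|G|) W : K :=
  match i with inl i => f i W | inr k => phi W * indic K (enum_val k) W end.
have phiE W : (phi W == 0) = ((\rank W %% b)%N \in Ks).
  by rewrite prodf_prim_root_eq0 // capmx1.
have fE i j : (f i (V j) == 0) = (i != j).
  rewrite prodf_prim_root_eq0 //; apply/idP/idP => [H|ij]; last first.
    by rewrite eq_sym in ij; have [mu muL ->] := hcap _ _ ij; rewrite modn_small ?hLb.
  apply: contraTneq H => <-; rewrite (capmx_idPl (submx_refl _)).
  by have [k kK ->] := hdim i; rewrite modn_small ?hKb // hKL.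
have phiV i : phi (V i) = 0.
  by apply/eqP; rewrite phiE; have [k kK ->] := hdim i; rewrite modn_small ?hKb.
have GD (k : 'I_#|G|) : D (\rank (enum_val k)) by have /andP[] := enum_valP k.
have Gc (k : 'I_#|G|) : <<enum_val k>>%MS = enum_val k by have /andP[/eqP] := enum_valP k.
have F_s i : spoly 1%:M s (F_ i).
  case: i => [i|k]; first exact: spoly_prod_qrank.
  have rs : (r <= s)%N by apply: leq_trans (Ds _ (GD k)); apply: leq_addl.
  rewrite -{1}(subnKC rs); apply: spoly_mul; first exact: spoly_prod_qrank.
  by apply: spoly_indic; rewrite ?submx1 // leq_subRL // addnC Ds.
have [a aE] := fin_all_exists (fun i => spoly_coef (F_s i)).
have : (#|{: 'I_m + 'I_#|G|}| <= #|S|)%N.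
  apply: (leq_card_indep (f := F_) (x := @indic F K n) (a := a)) => // c c0.
  (* At [V j] every term vanishes except the one with [f j]. *)
  have cl j : c (inl j) = 0.
    have := c0 (V j); rewrite big_sumType /= [X in _ + X]big1 ?addr0 => [|k _]; last first.
      by rewrite phiV mul0r mulr0.
    rewrite (bigD1 j) //= big1 ?addr0 => [/eqP|i ij]; last first.
      by have := fE i j; rewrite ij => /eqP->; rewrite mulr0.
    by rewrite mulf_eq0 fE eqxx orbF => /eqP.
  pose g W := \sum_(k < #|G|) c (inr k) * indic K (enum_val k) W.
  have g_s : spoly 1%:M (s - r) g.
    apply: spoly_sum => k _; apply: spoly_scale; apply: spoly_indic; rewrite ?submx1 //.
    have kD := Ds _ (GD k); have rs : (r <= s)%N by apply: leq_trans kD; apply: leq_addl.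
    by rewrite leq_subRL // addnC.
  have g0 W : (\rank W %% b)%N \notin Ks -> g W = 0.
    rewrite -phiE => W0; apply: (mulfI W0); rewrite mulr0 -[RHS](c0 W) big_sumType /=.
    rewrite [X in X + _]big1 ?add0r => [|i _]; last by rewrite cl mul0r.
    by rewrite mulr_sumr; apply: eq_bigr => k _; rewrite mulrCA.
  have gD := hD g g_s g0.
  (* Induction on rank: at a member U of [G] only the members inside U contribute to [g], and those
     other than U have smaller rank. *)
  have cr : forall N (k : 'I_#|G|), (\rank (enum_val k) < N)%N -> c (inr k) = 0.
    elim=> // N IH k; rewrite ltnS => kN.
    have := gD _ (GD k); rewrite /g (bigD1 k) //= /indic submx_refl mulr1 big1 ?addr0 // => l lk.
    case lek: (enum_val l <= enum_val k)%MS; last by rewrite mulr0.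
    rewrite IH ?mul0r //; apply: leq_trans kN.
    rewrite ltn_neqAle mxrankS // andbT; apply: contra lk => /eqP rE.
    have /genmxP : (enum_val l == enum_val k)%MS.
      by rewrite -(geq_leqif (mxrank_leqif_eq lek)) rE.
    by rewrite !Gc => /enum_val_inj ->.
  by case=> [j|k]; [apply: cl | apply: (cr (\rank (enum_val k)).+1)].
rewrite card_sum !card_ord.
rewrite -(cardID G S) addnC (@eq_card _ [predI S & G] G) => [|U]; last first.
  rewrite !inE; case: eqP => //= _; rewrite andb_idl // => /Ds; apply: leq_trans; exact: leq_addr.
rewrite leq_add2l; move/leq_trans; apply.
apply/subset_leq_card/subsetP => U; rewrite !inE.
by case: eqP => //= _; rewrite andbC.
Qed.

End Bound.

(** * Windows of consecutive dimensions *)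

Lemma spoly_window (F : finFieldType) (K : fieldType) (n d y : nat) (g : 'M[F]_n -> K) :
    #|F|%:R != 0 :> K -> spoly 1%:M d g -> (y + d <= n)%N ->
    (forall W, (y <= \rank W <= y + d)%N -> g W = 0) ->
  forall W, (\rank W <= y + d)%N -> g W = 0.
Proof.
move=> q0 gd yn g0.
(* [i] bounds the distance of the rank of W below y; each descent uses the d + 1 ranks just above
   it. *)
suff H i W : (y <= \rank W + i)%N -> (\rank W <= y + d)%N -> g W = 0.
  by move=> W; apply: (H y); apply: leq_addl.
elim: i W => [|i IH] W yW Wd; first by apply: g0; rewrite -(addn0 (\rank W)) yW addn0.
have [yr|ry] := leqP y (\rank W); first by apply: g0; rewrite yr.
apply: (@spoly_descent F K n q0 d 1%:M g (\rank W) gd) => //; rewrite ?submx1 ?mxrank1 //.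
  by apply: leq_trans yn; rewrite ltn_add2r.
move=> W1 _ /andP[r1 r2]; apply: IH.
  by apply: leq_trans yW _; rewrite addnS -addSn leq_add2r.
by apply: leq_trans r2 _; rewrite addnS -addSn leq_add2r.
Qed.

(** A bad start y is k - j modulo b for some k in S and j <= d, so fewer than b starts are bad. The
    least good y is 0 or has y - 1 in S, since otherwise y - 1 would be good too. *)
Lemma exists_window (b d kr : nat) (S : seq nat) :
    (size S * d.+1 < b)%N -> (forall x, x \in S -> (x < b)%N) ->
    (forall x, x \in S -> (x <= kr)%N) ->
  exists2 y, (y <= kr.+1)%N & forall j, (j <= d)%N -> ((y + j) %% b)%N \notin S.
Proof.
move=> Sb hb hkr.
pose P y := (y < b)%N && all (fun j => (y + j) %% b \notin S)%N (iota 0 d.+1).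
have exP : exists y, P y.
  case: (boolP (has P (iota 0 b))) => [/hasP[y _ Py]|/hasPn H]; first by exists y.
  move: Sb; rewrite ltnNge => /negP[].
  rewrite -{1}(size_iota 0 b) -(size_iota 0 d.+1).
  (* The summand [j * b] keeps the truncated subtraction of j exact. *)
  rewrite -(size_allpairs (fun k j => (k + j * b - j) %% b)%N).
  apply: uniq_leq_size (iota_uniq _ _) _ => y yb.
  have := H y yb; rewrite mem_iota add0n /= in yb.
  rewrite /P yb andTb => /allPn[j jd]; rewrite negbK => kS.
  apply/allpairsP; exists ((y + j) %% b, j)%N; split=> //=.
  have jb : (j <= j * b)%N by rewrite leq_pmulr // (leq_trans _ yb).
  by rewrite -addnBA // modnDml -addnA subnKC // addnC modnMDl modn_small.
case: (ex_minnP exP) => y /andP[yb /allP Py] ymin.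
exists y; last by move=> j jd; apply: Py; rewrite mem_iota.
case: y yb Py ymin => // y yb Py ymin; rewrite ltnS.
have yS : y \in S; last exact: hkr.
apply/negPn/negP => yS; have : P y; last by move/ymin; rewrite ltnn.
rewrite /P (ltnW yb); apply/allP => -[_|j]; first by rewrite addn0 modn_small // ltnW.
rewrite mem_iota => /andP[_ jd]; rewrite addnS -addSn; apply: Py.
by rewrite mem_iota leq0n (ltn_trans _ jd).
Qed.

(** * Counting subspaces by q-binomial coefficients *)

Section Count.
Variable F : finFieldType.

(** A new row may be any vector outside the span of d independent rows, which has q^d elements. *)
Lemma card_row_free d n : (d <= n)%N ->
  #|[pred A : 'M[F]_(d, n) | row_free A]| = (\prod_(i < d) (#|F| ^ n - #|F| ^ i))%N.
Proof.
elim: d => [|d IH] dn.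
  rewrite big_ord0 (@eq_card _ _ predT) ?card_mx ?mul0n // => A.
  by rewrite !inE /row_free eqn_leq rank_leq_row.
rewrite big_ord_recr /= -IH ?(ltnW dn) // mulnC.
pose h (p : 'rV[F]_n * 'M[F]_(d, n)) : 'M[F]_(1 + d, n) := col_mx p.1 p.2.
have h_inj : injective h by move=> [u B] [v C] /eq_col_mx /= [-> ->].
have freeE (u : 'rV[F]_n) (B : 'M[F]_(d, n)) : row_free (col_mx u B) = row_free B && ~~ (u <= B)%MS.
  rewrite /row_free -addsmxE.
  have [uB|uB] := boolP (u <= B)%MS.
    rewrite (addsmx_idPr uB) andbF; apply: negbTE; rewrite neq_ltn.
    by rewrite add1n ltnS rank_leq_row.
  by rewrite addsmxC rank_adds_row // andbT.
transitivity (\sum_(B : 'M[F]_(d, n) | row_free B) #|[pred u : 'rV[F]_n | ~~ (u <= B)%MS]|)%N.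
  rewrite -sum1_card (reindex h) /=; last first.
    exists (fun A : 'M[F]_(1 + d, n) => (usubmx A, dsubmx A)) => [[u B] _|A _].
      by rewrite /h /= col_mxKu col_mxKd.
    by rewrite /h /= vsubmxK.
  rewrite (eq_bigl (fun p : 'rV[F]_n * 'M[F]_(d, n) => row_free p.2 && ~~ (p.1 <= p.2)%MS)); last first.
    by move=> [u B]; rewrite inE /h freeE.
  rewrite -(pair_big_dep xpredT (fun u B => row_free B && ~~ (u <= B)%MS) (fun _ _ => 1%N)) /=.
  rewrite (exchange_big_dep (fun B => row_free B)) /=; last by move=> u B _ /andP[].
  apply: eq_bigr => B fB; rewrite -sum1_card.
  by apply: eq_bigl => u; rewrite inE fB.
rewrite -[#|[pred A | row_free A]|]sum1_card big_distrr /=.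
rewrite [RHS]big_mkcond [LHS]big_mkcond /=; apply: eq_bigr => B _.
rewrite inE; case: ifP => // fB; rewrite muln1.
have := cardC [pred u : 'rV[F]_n | (u <= B)%MS].
rewrite card_mx mul1n.
rewrite card_rowspace (eqP fB).
move=> <-; rewrite addKn; apply: eq_card => u; by rewrite !inE.
Qed.

Definition card_subspaces n d : nat :=
  #|[pred U : 'M[F]_n | (<<U>>%MS == U) && (\rank U == d)]|.

(** The bases of a fixed d-dimensional subspace are the [C *m B] for one basis B and all invertible
    C. *)
Lemma card_subspaces_row_free n d : (d <= n)%N ->
  (#|[pred A : 'M[F]_(d, n) | row_free A]|
   = card_subspaces n d * #|[pred A : 'M[F]_d | row_free A]|)%N.
Proof.
move=> dn; rewrite /card_subspaces -sum1_card.
rewrite (partition_big (fun A : 'M[F]_(d, n) => <<A>>%MS)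
  (fun U : 'M[F]_n => (<<U>>%MS == U) && (\rank U == d))) /=; last first.
  by move=> A; rewrite inE genmx_id eqxx mxrank_gen.
rewrite -sum_nat_const; apply: eq_big => [U|U /andP[/eqP gU /eqP rU]]; first by rewrite inE.
pose B : 'M[F]_(d, n) := castmx (rU, erefl n) (row_base U).
have BU : (B :=: U)%MS.
  by apply: eqmx_trans (eq_row_base U); apply: eqmx_cast.
have fB : row_free B by rewrite /row_free BU rU.
rewrite -[RHS]sum1_card (reindex_onto (fun C : 'M[F]_d => C *m B) (fun A => A *m pinvmx B)) /=; last first.
  by move=> A /andP[_ /eqP AU]; apply: mulmxKpV; rewrite BU -AU genmxE.
apply: eq_bigl => C; rewrite !inE mulmxKp // eqxx andbT.
rewrite /row_free mxrankMfree // andb_idr // => /eqP rC.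
rewrite -gU; apply/eqP/genmxP/eqmxP.
apply: eqmx_trans BU; apply: eqmxMfull.
by rewrite /row_full rC.
Qed.

(** Both counts of row-free matrices contain the product of the q^i with i < d, which cancels in the
    quotient. *)
Lemma card_subspacesE n d : (card_subspaces n d)%:R = qbinomial #|F| n%:Z d%:Z.
Proof.
rewrite /qbinomial lez_nat /=; case: ifP => dn; last first.
  rewrite /card_subspaces eq_card0 // => U; rewrite !inE; apply: contraFF dn => /andP[_ /eqP <-].
  exact: rank_leq_row.
have q1 : (1 < #|F|)%N := finNzRing_gt1 F.
have E m : (d <= m)%N -> #|[pred A : 'M[F]_(d, m) | row_free A]|%:R
   = \prod_(i < d) (#|F|%:R ^+ i) * \prod_(i < d) (#|F|%:R ^ (m%:Z - i%:Z) - 1) :> rat.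
  move=> dm; rewrite card_row_free // natr_prod -big_split /=; apply: eq_bigr => i _.
  have im : (i <= m)%N by apply: leq_trans dm; apply: ltnW.
  rewrite natrB ?leq_pexp2l // 1?ltnW // subzn // !natrX mulrBr mulr1 -exprnP -exprD subnKC //.
have := card_subspaces_row_free dn => /(congr1 (fun k => k%:R : rat)).
rewrite natrM !E // => H.
have nz m : (d <= m)%N -> \prod_(i < d) (#|F|%:R ^+ i) * \prod_(i < d) (#|F|%:R ^ (m%:Z - i%:Z) - 1) != 0 :> rat.
  move=> dm; rewrite -E // card_row_free // pnatr_eq0 -lt0n prodn_gt0 // => i.
  by rewrite subn_gt0 ltn_exp2l // (leq_trans _ dm).
have := nz d (leqnn d); rewrite mulf_eq0 negb_or => /andP[n1 n2].
apply: (mulIf n2); rewrite divfK //; apply: (mulfI n1).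
by rewrite mulrCA -H.
Qed.

End Count.

(** * The bounds as sums over dimensions *)

Lemma card_subspaces_sum (F : finFieldType) (n s : nat) (P : pred nat) :
  #|[pred U : 'M[F]_n | [&& <<U>>%MS == U, (\rank U <= s)%N & P (\rank U)]]|
  = (\sum_(d < s.+1 | P d) card_subspaces F n d)%N.
Proof.
rewrite -sum1_card.
rewrite (partition_big (fun U : 'M[F]_n => inord (\rank U) : 'I_s.+1) (fun d => P d)) /=; last first.
  by move=> U /and3P[_ Us PU]; rewrite inordK.
apply: eq_bigr => d Pd; rewrite -[RHS]sum1_card; apply: eq_bigl => U; rewrite !inE.
case: eqP => //= _; apply/idP/eqP => [/andP[/andP[Us _] /eqP <-]|->]; first by rewrite inordK.
by rewrite -ltnS ltn_ord Pd inord_val eqxx.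
Qed.

(** Substitute d = s - i. The terms of [qN] with i > s have a negative lower index and vanish. *)
Lemma qNE (F : finFieldType) (n s r : nat) :
  qN n s r #|F| = (\sum_(d < s.+1 | (s < d + r)%N) card_subspaces F n d)%N%:R.
Proof.
rewrite natr_sum (reindex_inj rev_ord_inj) /=.
pose G i : rat := (card_subspaces F n (s - i)%N)%:R.
transitivity (\sum_(i < s.+1 | (i < r)%N) G i); last first.
  by apply: eq_big => i; rewrite ?subSS //; have := ltn_ord i; rewrite ltnS => is'; apply/idP/idP; lia.
(* Both ranges are embedded in a common one, where either bound can be exchanged for a condition. *)
rewrite (big_ord_widen_cond (r + s.+1) (fun i => i < r)%N G) ?leq_addl //.
rewrite (eq_bigl (fun i : 'I_(r + s.+1) => (i < s.+1) && (i < r))%N); last by move=> i; rewrite andbC.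
rewrite -(big_ord_widen_cond (r + s.+1) (fun i => i < s.+1)%N G) ?leq_addr //.
rewrite [RHS]big_mkcond; apply: eq_bigr => i _.
case: ltnP => is'; first by rewrite subzn // -card_subspacesE.
by rewrite /qbinomial [X in if X then _ else _](_ : _ = false) //; lia.
Qed.

Lemma leq_sum_mem (s : nat) (K : seq nat) (G : nat -> nat) :
  (\sum_(d < s | (d : nat) \in K) G d <= \sum_(k <- K) G k)%N.
Proof.
elim: K => [|k K IH]; first by rewrite big1.
rewrite big_cons (bigID (fun d : 'I_s => d == k :> nat)) /=; apply: leq_add.
  have [ks|ks] := ltnP k s.
    rewrite (bigD1 (Ordinal ks)) /= ?inE ?eqxx // big1 ?addn0 // => i.
    by rewrite -val_eqE /= => /andP[/andP[_ /eqP->]]; rewrite eqxx.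
  by rewrite big1 // => i /andP[_ /eqP ik]; move: ks; rewrite -ik leqNgt ltn_ord.
apply: leq_trans IH; rewrite [leqRHS]big_mkcond [leqLHS]big_mkcond; apply: leq_sum => i _.
by rewrite inE; case: (_ == k); case: (_ \in K) => /=.
Qed.

Lemma sorted_leq_last (K : seq nat) x : sorted ltn K -> x \in K -> (x <= last 0%N K)%N.
Proof.
move=> sK xK; rewrite -nth_last -{1}(nth_index 0%N xK).
have sK' : sorted leq K by apply: sub_sorted sK => a b; apply: ltnW.
have K0 : (0 < size K)%N by case: (K) xK.
have ix : (index x K < size K)%N by rewrite index_mem.
by rewrite (sorted_leq_nth leq_trans leqnn) // ?inE ?prednK // -ltnS prednK.
Qed.

Lemma sorted_head_leq (K : seq nat) x : sorted ltn K -> x \in K -> (head 0%N K <= x)%N.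
Proof.
case: K => //= k K /(order_path_min ltn_trans) /allP kK; rewrite inE => /orP[/eqP->//|/kK].
exact: ltnW.
Qed.

(** * The two choices of auxiliary dimensions and the case distinction *)

Theorem theorem1p2 (q n : nat) (F : finFieldType) (hq : #|F| = q)
    (V : vectType F) (hn : (\dim {:V})%VS = n)
    (b : nat) (hb : (0 < b)%N)
    (r s : nat) (hr : (0 < r)%N)
    (K : r.-tuple nat) (L : s.-tuple nat)
    (hK : sorted ltn K) (hL : uniq L)
    (hKb : forall x, x \in K -> (x < b)%N)
    (hLb : forall x, x \in L -> (x < b)%N)
    (hKL : forall x, x \in K -> x \notin L)
    (m : nat) (V_ : 'I_m -> {vspace V})
    (hdim : forall i : 'I_m,
       exists2 k, k \in K & (\dim (V_ i) = k %[mod b])%N)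
    (hcap : forall i j : 'I_m, i != j ->
       exists2 mu, mu \in L & (\dim (V_ i :&: V_ j)%VS = mu %[mod b])%N)
    (hex1 : ~ ((exists e : nat, (q + 1 = 2 ^ e)%N) /\ b = 2%N))
    (hex2 : ~ (q = 2%N /\ b = 6%N)) :
  let k1 := head 0%N K in
  let kr := last 0%N K in
  m%:R <=
    if ((s + kr <= n)%N && (r%:Z * (s%:Z - r%:Z + 1) <= b%:Z - 1))
       || (s < k1 + r)%N
    then qN n s r q
    else qN n s r q + \sum_(k <- K) qbinomial q n%:Z k%:Z.
Proof.
cbv zeta; subst q n; set k1 := head 0%N K; set kr := last 0%N K.
have sb : (s <= b)%N.
  rewrite -(size_tuple L) -(size_iota 0 b); apply: uniq_leq_size => // x /hLb.
  by rewrite mem_iota.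
have ge0 : 0 <= \sum_(k <- K) qbinomial #|F| (\dim {:V})%:Z k%:Z.
  by apply: sumr_ge0 => k _; rewrite -card_subspacesE ler0n.
(* An empty L allows at most one member. This case stands apart because b = 1 can occur only
   here. *)
have [s0|s0] := posnP s.
  subst s; have m1 : (m <= 1)%N.
    rewrite leqNgt; apply/negP => m2.
    have [mu] := @hcap (Ordinal (ltnW m2)) (Ordinal m2) isT.
    by rewrite (tuple0 L).
  have N1 : (1 : rat) = qN (\dim {:V}) 0 r #|F|.
    rewrite qNE big_mkcond big_ord1 /= hr.
    apply/eqP; rewrite -[1]/(1%:R) eqr_nat; apply/eqP.
    have := card_subspaces_row_free F (leq0n (\dim {:V})).
    by rewrite !card_row_free // !big_ord0 muln1.
  have {}m1 : m%:R <= (1 : rat) by rewrite -[1]/(1%:R) ler_nat.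
  by case: ifP => _; rewrite -N1 // (le_trans m1) // lerDl.
have b1 : (1 < b)%N.
  rewrite ltn_neqAle hb andbT; apply/eqP => b1; subst b.
  have kK : nth 0%N K 0 \in K by rewrite mem_nth // size_tuple.
  have lL : nth 0%N L 0 \in L by rewrite mem_nth // size_tuple.
  have := hKL _ kK; have := hKb _ kK; have := hLb _ lL.
  by rewrite !ltnS !leqn0 => /eqP lE /eqP ->; rewrite -lE lL.
have [p pp pz] := zsigmondy (finNzRing_gt1 F) b1 hex1 hex2.
pose W i := VectorInternalTheory.vs2mx (V_ i).
have hdimW i : exists2 k, k \in (K : seq nat) & (\rank (W i) = k %[mod b])%N by exact: hdim.
have hcapW i j : i != j ->
    exists2 mu, mu \in (L : seq nat) & (\rank (W i :&: W j)%MS = mu %[mod b])%N.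
  by move=> /hcap[mu muL E]; exists mu => //; rewrite -E /dimv /= mxrank_gen.
have bound := family_bound pz hKb hLb hKL hdimW hcapW.
rewrite !size_tuple in bound.
have dimE : dim V = \dim {:V} by rewrite dimvf.
(* All dimensions up to s - r are used, by descent from a window of s - r + 1 dimensions avoiding K
   modulo b. *)
have bound1 : (s + kr <= \dim {:V})%N && (r%:Z * (s%:Z - r%:Z + 1) <= b%:Z - 1) ->
    (m <= \sum_(d < s.+1 | (s < d + r)%N) card_subspaces F (\dim {:V}) d)%N.
  move=> /andP[skn rsb].
  have := bound (fun d => d + r <= s)%N; rewrite (@card_subspaces_sum F _ s (fun d => ~~ (d + r <= s))%N) dimE.
  under eq_bigl => d do rewrite -ltnNge.
  apply=> // g gs g0 U Us.
  have rs : (r <= s)%N by apply: leq_trans Us; apply: leq_addl.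
  have [|y ykr Hy] := @exists_window b (s - r) kr K _ hKb (fun x => sorted_leq_last hK).
    rewrite size_tuple; move: rsb; rewrite subzn // -(PoszD _ 1) -PoszM lerBrDr -PoszD lez_nat; lia.
  apply: (spoly_window (y := y) (d := s - r) _ gs).
  - by rewrite (prim_root_eq0 pz) -lt0n.
  (* y + (s - r) <= k_r + 1 + (s - r) <= s + k_r because r >= 1. *)
  - apply: leq_trans skn; lia.
  - move=> U1 /andP[yU Ud]; apply: g0; rewrite -(subnKC yU); apply: Hy.
    by rewrite leq_subLR.
  - apply: leq_trans (leq_addl _ _); lia.
(* Only dimensions d outside K are used. From d + r <= s <= b and r > 0, d is its own residue modulo
   b, so [g] vanishes there directly. *)
have bound2 : (m <= \sum_(d < s.+1 | (s < d + r)%N || ((d : nat) \in (K : seq nat)))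
    card_subspaces F (\dim {:V}) d)%N.
  have := bound (fun d => (d + r <= s) && (d \notin (K : seq nat)))%N.
  rewrite (@card_subspaces_sum F _ s (fun d => ~~ ((d + r <= s) && (d \notin (K : seq nat))))%N) dimE.
  under eq_bigl => d do rewrite negb_and negbK -ltnNge.
  apply=> [d /andP[]//|g gs g0 U /andP[Us UK]].
  by apply: g0; rewrite modn_small //; apply: leq_trans sb; lia.
case: ifP => [/orP[/bound1 H|sk]|_].
- by rewrite qNE ler_nat.
(* Every k in K satisfies s < k + r, so K contributes no further dimension. *)
- rewrite qNE ler_nat; apply: leq_trans bound2 _; apply: eq_leq; apply: eq_bigl => d.
  rewrite orb_idr // => /(sorted_head_leq hK) dk.
  by apply: leq_trans sk _; rewrite leq_add2r.
rewrite qNE; under [X in _ <= _ + X]eq_bigr => k _ do rewrite -card_subspacesE.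
rewrite -natr_sum -natrD ler_nat; apply: leq_trans bound2 _.
apply: leq_trans (leq_add (leqnn _) (@leq_sum_mem s.+1 K _)).
rewrite [leqLHS]big_mkcond [X in (_ <= X + _)%N]big_mkcond [X in (_ <= _ + X)%N]big_mkcond -big_split /=.
by apply: leq_sum => d _; case: (s < d + r)%N; case: (_ \in _); rewrite ?addn0 ?leq_addr.
Qed.
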